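(* Let $D$ be a diagram of an oriented link, let $\Sigma_D$ be the Seifert surface obtained by applying Seifert's algorithm to $D$, let $\sigma_D$ be the orientation-induced smoothing of $D$, let $\Gamma_{\sigma_D}$ be its state graph, and let $\Gamma_0$ be the subgraph of $\Gamma_{\sigma_D}$ formed by the $0$-traces. The relative Khovanov-Jacobsson cycle $\mathcal{C}\mathrm{KJ}_{\Sigma_D}\in\mathcal{C}\mathrm{Kh}(D)$ of $\Sigma_D$ (computed from the Seifert-algorithm movie of $\Sigma_D$) is determined by the first Betti number $b^1(\Gamma_0)$. Explicitly, if $\Gamma_0$ is connected, then, up to an overall sign: (a) if $b^1(\Gamma_0)=0$, then $\mathcal{C}\mathrm{KJ}_{\Sigma_D}=\sum_{v}(-1)^{d(v,v_0)}\alpha_v$, where the sum is over the vertices $v$ of $\Gamma_0$, $v_0$ is a predetermined vertex of $\Gamma_0$, $d$ is the distance in $\Gamma_0$, and $\alpha_v$ is the enhanced state on $\sigma_D$ in which $v$ is labeled $1$, every other vertex of $\Gamma_0$ is labeled $x$, and every circle of $\sigma_D$ that is not a vertex of $\Gamma_0$ is labeled $1$; (b) if $b^1(\Gamma_0)=1$, then $\mathcal{C}\mathrm{KJ}_{\Sigma_D}$ is twice the enhanced state on $\sigma_D$ in which every vertex of $\Gamma_0$ is labeled $x$ and all other circles are labeled $1$; (c) if $b^1(\Gamma_0)\geq2$, then $\mathcal{C}\mathrm{KJ}_{\Sigma_D}=0$.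
   Context: For a link diagram $D$, $\mathcal{C}\mathrm{Kh}(D)$ is the bigraded Khovanov chain complex over $\mathbb{Z}$, generated by enhanced states: states (choices of $0$- or $1$-smoothing at every crossing) with each circle labeled $1$ or $x$. $\mathcal{C}\mathrm{Kh}(\emptyset)=\mathbb{Z}$. A movie of an oriented surface from $\emptyset$ to $D$ (a sequence of isotopies, Morse moves and Reidemeister moves) induces, by composing the standard Khovanov chain maps of the moves, a chain map $\mathcal{C}\mathrm{Kh}(\emptyset)\to\mathcal{C}\mathrm{Kh}(D)$; the image of $1$ is the relative Khovanov-Jacobsson cycle $\mathcal{C}\mathrm{KJ}$ of the surface (the induced maps are considered up to sign). The orientation-induced smoothing $\sigma_D$ is the state in which every positive crossing is $0$-smoothed and every negative crossing is $1$-smoothed; its circles are the Seifert circles. The state graph $\Gamma_{\sigma_D}$ has the circles of $\sigma_D$ as vertices and one edge (trace) for each crossing of $D$, joining the circles adjacent to the smoothed crossing; it is a $0$-trace or $1$-trace according to the type of smoothing. $\Gamma_0$ is the subgraph whose edges are all the $0$-traces (that is, the positive crossings), and whose vertices are the circles incident to them; circles not incident to a $0$-trace are not vertices of $\Gamma_0$. Seifert's algorithm: each Seifert circle bounds a disk, with an outermost disk placed below any disk it contains, and each crossing is realized by a twisted band joining two disks, giving an oriented surface $\Sigma_D$ bounded by the link. Its movie is: (1) birth each Seifert disk, lowest (outermost) first; (2) for each negative crossing, perform a negative twist-and-glue move, consisting of a negative Reidemeister I move (creating a negative kink) followed by one Morse saddle; (3) for each positive crossing, perform a positive twist-and-glue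 move, consisting of a positive Reidemeister I move (creating a positive kink) followed by one Morse saddle. In each twist-and-glue move, the kink is created on one Seifert circle and the saddle merges its small loop with the other Seifert circle at the crossing. Chain maps involved, in terms of $A=\mathbb{Z}[x]/(x^2)$: a birth labels the new circle $1$; a Morse saddle induces the usual merge (multiplication of $A$) and split maps of Khovanov homology; creating a negative kink on a strand labeled $v$ gives, up to sign, $v\otimes1$ on the $1$-smoothing of the kink (the second factor being the new small circle); creating a positive kink on a strand labeled $v$ gives, up to sign, $v\otimes x-xv\otimes1$ on the $0$-smoothing of the kink. *)

(* Defs.v *)
From HB Require Import structures.
From mathcomp Require Import all_boot all_order all_algebra all_fingroup.

Set Implicit Arguments.
Unset Strict Implicit.
Unset Printing Implicit Defensive.

Import GRing.Theory.
Local Open Scope ring_scope.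

(** * Oriented diagrams *)

(* An oriented diagram is encoded through its oriented resolution.  [A] and [C]
   are types of names; [arcs X] and [crossings X] are the arcs and crossings
   actually present in [X].  Draw a crossing [c] with both strands pointing
   upwards: [lft X c] and [rgt X c] are the two incoming (bottom) arcs, and
   [next X (lft X c)], [next X (rgt X c)] are the outgoing arcs at the top left
   and at the top right.  So [next] follows the oriented smoothing: its orbits
   are the Seifert circles, and the strands of the link at [c] run from
   [lft X c] to [next X (rgt X c)] and from [rgt X c] to [next X (lft X c)].
   The sign of [c] tells which of the two is the over strand (the first one iff
   [c] is positive).  The end of an arc which is at no crossing is only a marked
   point of the diagram, where [a] continues as [next X a]. *)
Record diagram (A C : finType) := Diagram {
  arcs : {set A};
  crossings : {set C};
  next : {perm A};
  lft : C -> A;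
  rgt : C -> A;
  positive : C -> bool
}.

Section Diagrams.
Variables (A C : finType) (X : diagram A C).

Definition well_formed : Prop :=
  [/\ forall a, a \in arcs X -> next X a \in arcs X,
      forall c, c \in crossings X -> lft X c \in arcs X /\ rgt X c \in arcs X,
      {in crossings X &, injective (lft X)},
      {in crossings X &, injective (rgt X)}
    & {in crossings X &, forall c c', lft X c != rgt X c'}].

(* Arcs have no superfluous subdivision: an arc which does not end at a crossing
   is a whole crossingless circle. *)
Definition unmarked : Prop :=
  forall a, a \in arcs X ->
    (forall c, c \in crossings X -> a != lft X c /\ a != rgt X c) ->
    next X a = a.

(* Planarity is Euler's formula for the combinatorial map of the diagram.  The
   dart [(a, true)] is the final half of the arc [a] and [(a, false)] its initial
   half.  [node] turns counterclockwise around the vertices, that is around the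
   crossings (bottom left, bottom right, top right, top left) and around the
   2-valent marked points. *)
Definition darts : {set A * bool} := [set d | d.1 \in arcs X].

Definition edge (d : A * bool) : A * bool := (d.1, ~~ d.2).

Definition node (d : A * bool) : A * bool :=
  if d.2 then
    if [pick c in crossings X | lft X c == d.1] is Some c
    then (rgt X c, true) else (next X d.1, false)
  else
    let a := (next X)^-1%g d.1 in
    if [pick c in crossings X | rgt X c == a] is Some c
    then (next X (lft X c), false) else (a, true).

Definition face (d : A * bool) : A * bool := node (edge d).

Definition glink : rel (A * bool) :=
  [rel d d' | (d' == edge d) || (d' == node d)].

Definition planar : Prop :=
  (fcard node darts + fcard edge darts + fcard face darts
     = #|darts| + (n_comp glink darts).*2)%N.

Definition link_diagram : Prop := [/\ well_formed, unmarked & planar].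

(** * States and Khovanov chains *)

(* A state is the set [s] of its 1-smoothed crossings.  The smoothing agrees with
   the orientation exactly for the 0-smoothing of a positive crossing and the
   1-smoothing of a negative one; otherwise it joins the two incoming arcs to
   each other, and the two outgoing ones. *)
Definition turned (s : {set C}) (c : C) : bool := (c \in s) == positive X c.

Definition glued (s : {set C}) (a b : A) : bool :=
  ((b == next X a) &&
     ~~ [exists c in crossings X,
           turned s c && ((a == lft X c) || (a == rgt X c))])
  || [exists c in crossings X, turned s c &&
        (((a == lft X c) && (b == rgt X c)) ||
         ((a == next X (lft X c)) && (b == next X (rgt X c))))].

Definition circle (s : {set C}) (a : A) : {set A} :=
  [set b | connect [rel u v | glued s u v || glued s v u] a b].

Definition circles (s : {set C}) : {set {set A}} :=
  [set circle s a | a in arcs X].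

(* An enhanced state is a pair [(s, l)] of a state [s] and a set [l] of arcs which
   is a union of circles of [s], namely those labeled x; the others are
   labeled 1. *)
Definition is_enhanced (e : {set C} * {set A}) : bool :=
  [&& e.1 \subset crossings X, e.2 \subset arcs X
    & [forall a in e.2, circle e.1 a \subset e.2]].

Definition enhanced := {e : {set C} * {set A} | is_enhanced e}.

(* The free abelian group on the enhanced states. *)
Definition CKh := {ffun enhanced -> int}.

(* The generator [(s, l)]; 0 if [(s, l)] is not an enhanced state. *)
Definition kgen (s : {set C}) (l : {set A}) : CKh :=
  [ffun e : enhanced => ((val e == (s, l)) : nat)%:Z].

Definition seifert_state : {set C} :=
  [set c in crossings X | ~~ positive X c].

End Diagrams.

Definition lin (A C A' C' : finType) (X : diagram A C) (Y : diagram A' C')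
    (f : {set C} -> {set A} -> CKh Y) (z : CKh X) : CKh Y :=
  \sum_(e : enhanced X) f (val e).1 (val e).2 *~ z e.

(** * Elementary moves and their chain maps *)

(* Induced by a birth when [Y] is [X] with an additional crossingless circle,
   which gets the label 1; the identity when [Y] is [X]. *)
Definition birth_map (A C : finType) (X Y : diagram A C) : CKh X -> CKh Y :=
  lin (fun s l => kgen Y s l).

(* Oriented saddle between the initial parts of the arcs [p] and [q]. *)
Definition saddle (A C : finType) (X : diagram A C) (p q : A) : diagram A C :=
  Diagram (arcs X) (crossings X) (next X * tperm p q)%g (lft X) (rgt X)
    (positive X).

(* Split (1 to 1.x + x.1, x to x.x) if [p] and [q] are on the same circle, merge
   (1.1 to 1, 1.x and x.1 to x, x.x to 0) otherwise. *)
Definition saddle_map (A C : finType) (X : diagram A C) (p q : A) :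
    CKh X -> CKh (saddle X p q) :=
  let Y := saddle X p q in
  lin (fun s l =>
    if q \in circle X s p then
      if p \in l then kgen Y s l
      else kgen Y s (l :|: circle Y s p) + kgen Y s (l :|: circle Y s q)
    else
      if (p \in l) && (q \in l) then 0
      else if (p \in l) || (q \in l)
        then kgen Y s (l :|: circle X s p :|: circle X s q)
        else kgen Y s l).

Definition next_kink (A C : finType) (X : diagram A C) : {perm option A} :=
  perm (inj_omap (@perm_inj A (next X))).

(* Reidemeister I move creating, at the marked end of the arc [a], a kink with
   crossing [c] of sign [sgn].  The loop of the kink is the new arc [None]; it
   lies to the right of [a] if [onleft] (so that [a] comes in at the left of
   [c]), and to its left otherwise. *)
Definition kink (A C : finType) (X : diagram A C) (c : C) (a : A)
    (onleft sgn : bool) : diagram (option A) C :=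
  Diagram (None |: (Some @: arcs X)) (c |: crossings X) (next_kink X)
    (fun c' => if c' == c then if onleft then Some a else None
               else Some (lft X c'))
    (fun c' => if c' == c then if onleft then None else Some a
               else Some (rgt X c'))
    (fun c' => if c' == c then sgn else positive X c').

(* Representatives of the maps defined up to sign: for a strand labeled v,
   v.x - xv.1 on the 0-smoothing of a positive kink, and v.1 on the 1-smoothing
   of a negative kink. *)
Definition kink_map (A C : finType) (X : diagram A C) (c : C) (a : A)
    (onleft sgn : bool) : CKh X -> CKh (kink X c a onleft sgn) :=
  let Y := kink X c a onleft sgn in
  lin (fun s l =>
    if sgn then
      kgen Y s (None |: (Some @: l))
      - (if a \in l then 0 else kgen Y s (Some @: (l :|: circle X s a)))
    else kgen Y (c |: s) (Some @: l)).

(* Induced by the planar isotopy which absorbs the arc [None] of [X] into its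
   predecessor, forgetting the marked point between them. *)
Definition absorb_map (A C : finType) (X : diagram (option A) C)
    (Y : diagram A C) : CKh X -> CKh Y :=
  lin (fun s l => kgen Y s (Some @^-1: l)).

(** * The movie of Seifert's algorithm *)

Section Seifert.
Variables (A C : finType) (D : diagram A C).

(* The part of [D] made of the Seifert circles with arcs in [Q], with only the
   crossings in [P]; the other crossings are replaced by marked points. *)
Definition frame (Q : {set A}) (P : {set C}) : diagram A C :=
  Diagram Q P (next D) (lft D) (rgt D) (positive D).

(* The kink is made at the end of [a], on one of the two Seifert circles at [c];
   its loop, the arc [None], is then merged with the other Seifert circle, right
   after the end of [b], so that [b] becomes [b] followed by [None], which is
   the second arc arriving at [c]. *)
Definition twist_and_glue (P : {set C}) (c : C) (onleft : bool)
    (z : CKh (frame (arcs D) P)) : CKh (frame (arcs D) (c |: P)) :=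
  let a := if onleft then lft D c else rgt D c in
  let b := if onleft then rgt D c else lft D c in
  absorb_map _
    (saddle_map None (Some (next D b))
      (kink_map c a onleft (positive D c) z)).

Fixpoint run_glues (P : {set C}) (cs : seq (C * bool)) :
    CKh (frame (arcs D) P) -> CKh D :=
  if cs is (c, onleft) :: cs'
  then fun z => run_glues cs' (twist_and_glue c onleft z)
  else birth_map D.

Fixpoint run_births (Q : {set A}) (bs : seq {set A}) :
    CKh (frame Q set0) -> CKh (frame (arcs D) set0) :=
  if bs is K :: bs'
  then fun z => run_births bs' (birth_map (frame (K :|: Q) set0) z)
  else birth_map (frame (arcs D) set0).

(* An order of the births, an order of the negative and of the positive
   twist-and-glue moves, and for each of these the Seifert circle ([true] for
   the left one) on which the kink is created. *)
Record seifert_movie := SeifertMovie {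
  births : seq {set A};
  negs : seq (C * bool);
  poss : seq (C * bool);
  _ : perm_eq births (enum (circles D (seifert_state D)));
  _ : perm_eq [seq t.1 | t <- negs]
        (enum [set c in crossings D | ~~ positive D c]);
  _ : perm_eq [seq t.1 | t <- poss]
        (enum [set c in crossings D | positive D c])
}.

Definition CKJ (m : seifert_movie) : CKh D :=
  run_glues (negs m ++ poss m)
    (run_births (births m) (kgen (frame set0 set0) set0 set0)).

End Seifert.

(** * Graphs *)

Record multigraph (V E : finType) := Multigraph {
  verts : {set V};
  edges : {set E};
  end1 : E -> V;
  end2 : E -> V
}.

Section Graphs.
Variables (V E : finType) (G : multigraph V E).

Definition adjacent : rel V :=
  [rel v w | [exists e in edges G,
     ((end1 G e == v) && (end2 G e == w)) ||
     ((end1 G e == w) && (end2 G e == v))]].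

Definition graph_connected : Prop :=
  {in verts G &, forall v w, connect adjacent v w}.

(* Length of a shortest walk ([#|V|] if there is none). *)
Definition distance (v w : V) : nat :=
  find (fun n => [exists p : n.-tuple V, path adjacent v p && (last v p == w)])
    (iota 0 #|V|).

(* Matrix of the coboundary from 0-cochains to 1-cochains, acting on row
   vectors; edges are oriented from [end1] to [end2]. *)
Definition coboundary : 'M[rat]_(#|verts G|, #|edges G|) :=
  \matrix_(i, j) (((end2 G (enum_val j) == enum_val i) : nat)%:R
                  - ((end1 G (enum_val j) == enum_val i) : nat)%:R).

(* Dimension of the first cohomology group, the cokernel of the coboundary. *)
Definition betti1 : nat := (#|edges G| - \rank coboundary)%N.

End Graphs.

Section StateGraph.
Variables (A C : finType) (D : diagram A C).

(* A turned smoothing has one local arc at the bottom and one at the top of the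
   crossing. *)
Definition state_graph (s : {set C}) : multigraph {set A} C :=
  Multigraph (circles D s) (crossings D)
    (fun c => circle D s (lft D c))
    (fun c => circle D s (if turned D s c then next D (lft D c) else rgt D c)).

Definition zero_trace_graph (s : {set C}) : multigraph {set A} C :=
  let G := state_graph s in
  let E0 := [set c in edges G | c \notin s] in
  Multigraph
    [set v in verts G | [exists c in E0, (end1 G c == v) || (end2 G c == v)]]
    E0 (end1 G) (end2 G).

Definition Gamma0 : multigraph {set A} C := zero_trace_graph (seifert_state D).

(* The enhanced state on the oriented smoothing in which the circles in [S] are
   labeled x and all others 1. *)
Definition seifert_gen (S : {set {set A}}) : CKh D :=
  kgen D (seifert_state D) (cover S).

Definition alpha (v : {set A}) : CKh D := seifert_gen (verts Gamma0 :\ v).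

Definition eq_up_to_sign (y z : CKh D) : Prop := y = z \/ y = - z.

End StateGraph.

(* Main.v *)
From HB Require Import structures.
From mathcomp Require Import all_boot all_order all_algebra all_fingroup.
From mathcomp Require Import zify.
Require Import Defs.

Set Implicit Arguments.
Unset Strict Implicit.
Unset Printing Implicit Defensive.

Import GRing.Theory Num.Theory.
Local Open Scope ring_scope.

(** Reading the label x of a Seifert circle K as a variable x_K with square 0,
    the chains on the oriented smoothing are square-free polynomials in the
    Seifert circles, and each move of the movie acts on them as follows.  The
    births produce the constant 1.  A negative twist-and-glue move is the
    identity: its kink has a loop labeled 1, and merging with 1 changes nothing.
    A positive one multiplies by x_b - x_a, where a is the circle bearing the
    kink and b the other circle at the crossing ([twist_and_glue_kgen]).  Hence,
    up to sign, the cycle is the product of x_u - x_w over the edges uw of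
    [Gamma0 D] ([CKJ_realize], [twist_poly_edge_prod]).

    This product is computed for a connected bipartite graph by adding edges one
    at a time around a vertex ([edge_prod_level]).  Let W be the current set of
    vertices.  The product starts at the alternating sum of the x_(W - v), v in
    W.  An edge to a new vertex preserves the shape of the product and extends
    W; an edge inside W sends the alternating sum to 2 x_W, because the two ends
    of the edge have opposite signs, and sends 2 x_W to 0.  So the shape depends
    only on the number of independent cycles, |E| + 1 - |V|, which is the first
    Betti number ([betti1_connected]).

    That [Gamma0 D] is bipartite is where planarity enters.  By Euler's formula
    the coboundary matrices of the 1-skeleton of the diagram and of its dual
    graph are exact at the arcs, and every vertex has as many incoming as
    outgoing arcs; so there is a function on the faces which increases by 1
    whenever an arc is crossed from its left to its right
    ([alexander_numbering]).  Its value on the left of an arc is constant along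
    each Seifert circle and differs by 1 between the two circles at a crossing
    ([seifert_heights]); its parity is a 2-colouring ([Gamma0_bipartite]), which
    also computes the signs (-1)^d(v, v0) ([distance_parity]). *)

(** * Chains up to sign *)

Definition pm_eq (M : zmodType) (y z : M) : Prop := y = z \/ y = - z.

Lemma pm_eq_refl (M : zmodType) (y : M) : pm_eq y y.
Proof. by left. Qed.

Lemma pm_eq_sym (M : zmodType) (y z : M) : pm_eq y z -> pm_eq z y.
Proof. by case=> ->; [left | right; rewrite opprK]. Qed.

Lemma pm_eq_trans (M : zmodType) (x y z : M) :
  pm_eq x y -> pm_eq y z -> pm_eq x z.
Proof. by case=> -> [] ->; rewrite ?opprK; [left | right | right | left]. Qed.

Lemma pm_eq_additive (M N : zmodType) (f : {additive M -> N}) (y z : M) :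
  pm_eq y z -> pm_eq (f y) (f z).
Proof. by case=> ->; [left | right; rewrite raddfN]. Qed.

Lemma pm_eq_sign (M : zmodType) (y : M) (b : bool) : pm_eq (y *~ (-1) ^+ b) y.
Proof. by case: b; [right; rewrite expr1 mulrNz | left; rewrite expr0]. Qed.

(** * Square-free polynomials *)

Section SquareFree.
Variable V : finType.

Local Notation sqfree := {ffun {set V} -> int}.

Implicit Types (f : sqfree) (S W : {set V}) (u v w : V).

(** A polynomial is the function giving the coefficient of each square-free
    monomial, and a monomial is the set of its variables. *)
Definition mono S : sqfree := [ffun T : {set V} => (T == S)%:Z].

Definition xmul v (f : sqfree) : sqfree :=
  [ffun S : {set V} => if v \in S then f (S :\ v) else 0].

Lemma xmul_is_zmod_morphism v : zmod_morphism (xmul v).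
Proof.
by move=> f g; apply/ffunP => S; rewrite !ffunE; case: ifP; rewrite ?subr0.
Qed.
HB.instance Definition _ v :=
  GRing.isZmodMorphism.Build sqfree sqfree (xmul v) (xmul_is_zmod_morphism v).

Lemma xmul_mono v S :
  xmul v (mono S) = if v \in S then 0 else mono (v |: S).
Proof.
apply/ffunP => T; rewrite !ffunE.
have [vS|vS] := boolP (v \in S); rewrite !ffunE.
  case: ifP => // vT; case: eqP => // E.
  by move: vS; rewrite -E !inE eqxx.
case: ifP => vT.
  congr (nat_of_bool _)%:Z.
  by apply/eqP/eqP => [<-|->]; rewrite ?setD1K ?setU1K.
by case: eqP => // E; move: vT; rewrite E setU11.
Qed.

Lemma xmulC u v f : xmul u (xmul v f) = xmul v (xmul u f).
Proof.
apply/ffunP => S; rewrite !ffunE !inE.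
have [->|uv] := eqVneq u v => //.
by case: (u \in S); case: (v \in S); rewrite // !setDDl setUC.
Qed.

End SquareFree.

(** * Products of differences over the edges of a graph *)

Section EdgeProducts.
Variables (V E : finType) (G : multigraph V E).

Local Notation sqfree := {ffun {set V} -> int}.
Implicit Types (f : sqfree) (W : {set V}) (u v w : V) (e : E) (s : seq E).

Definition edge_diff e (f : sqfree) : sqfree :=
  xmul (end1 G e) f - xmul (end2 G e) f.

Lemma edge_diff_is_zmod_morphism e : zmod_morphism (edge_diff e).
Proof.
move=> f g; rewrite /edge_diff (raddfB (xmul (end1 G e))).
by rewrite (raddfB (xmul (end2 G e))) opprD addrACA -opprD.
Qed.
HB.instance Definition _ e :=
  GRing.isZmodMorphism.Build sqfree sqfree (edge_diff e)
    (edge_diff_is_zmod_morphism e).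

Lemma edge_diffC e e' f :
  edge_diff e (edge_diff e' f) = edge_diff e' (edge_diff e f).
Proof.
rewrite /edge_diff.
rewrite (raddfB (xmul (end1 G e))) (raddfB (xmul (end2 G e))).
rewrite (raddfB (xmul (end1 G e'))) (raddfB (xmul (end2 G e'))).
rewrite /= !(xmulC (end1 G e')) !(xmulC (end2 G e')) !opprB.
by rewrite addrACA [in RHS]addrACA [- xmul (end1 _ _) _ + _]addrC.
Qed.

Definition edge_prod s (f : sqfree) : sqfree := foldl (fun g e => edge_diff e g) f s.

Lemma edge_prod_diff s e f :
  edge_prod s (edge_diff e f) = edge_diff e (edge_prod s f).
Proof. by elim: s f => //= e' s IH f; rewrite edge_diffC IH. Qed.

(** The movie fixes an order of the crossings; this lemma trades it for the
    order in which the graph grows connectedly. *)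
Lemma perm_edge_prod s t f : perm_eq s t -> edge_prod s f = edge_prod t f.
Proof.
elim: s t f => [|e s IH] t f; first by rewrite perm_sym => /perm_nilP ->.
move=> st; have et : e \in t by rewrite -(perm_mem st) mem_head.
case/path.splitPr: et st => t1 t2; rewrite perm_sym perm_catC /= perm_cons perm_catC.
rewrite perm_sym => st; rewrite /= (IH _ _ st) /edge_prod !foldl_cat /=.
by rewrite -!/(edge_prod _ _) edge_prod_diff.
Qed.

Lemma pm_edge_prod s f g : pm_eq f g -> pm_eq (edge_prod s f) (edge_prod s g).
Proof. by elim: s f g => //= e s IH f g fg; apply/IH/pm_eq_additive. Qed.

Variable col : V -> bool.

(** The product, up to sign, of the differences over the edges of a connected
    graph with vertices [W], proper 2-colouring [col] and first Betti number
    [k]. *)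
Definition level W (k : nat) : sqfree :=
  match k with
  | 0 => \sum_(v in W) mono (W :\ v) *~ (-1) ^+ col v
  | 1 => mono W *+ 2
  | _ => 0
  end.

Lemma xmul_level0 u W : u \in W ->
  xmul u (level W 0) = mono W *~ (-1) ^+ col u.
Proof.
move=> uW; rewrite /level raddf_sum (bigD1 u) //= big1 => [|v /andP[vW vu]].
  by rewrite raddfMz /= xmul_mono !inE eqxx /= setD1K // addr0.
by rewrite raddfMz /= xmul_mono !inE uW eq_sym vu /= mul0rz.
Qed.

Lemma xmul_level_new w W k : w \notin W ->
  level (w |: W) k =
    xmul w (level W k) + (if k is 0 then mono W *~ (-1) ^+ col w else 0).
Proof.
move=> wW; case: k => [|[|k]] /=; last by rewrite raddf0 add0r.
  rewrite big_setU1 //= setU1K // addrC raddf_sum; congr (_ + _).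
  apply: eq_bigr => v vW; rewrite raddfMz /= xmul_mono !inE (negPf wW) andbF.
  congr (mono _ *~ _); apply/setP => y; rewrite !inE.
  by have [->|] := eqVneq y w => //=; case: eqVneq vW wW => // -> ->.
by rewrite raddfMn /= xmul_mono (negPf wW) addr0.
Qed.

(** For [k = 0], multiplying by x_w adds w to every monomial, while x_u only
    keeps the monomial that omits u and turns it into x_W.  That is the monomial
    of [w |: W] omitting w, with the right sign since [u] and [w] have opposite
    colours. *)
Lemma diff_level_new u w W k : u \in W -> w \notin W -> col w != col u ->
  xmul u (level W k) - xmul w (level W k) = - level (w |: W) k.
Proof.
move=> uW wW cuw; rewrite xmul_level_new //.
case: k => [|[|k]]; last by rewrite /level (raddf0 (xmul u)) (raddf0 (xmul w)) addr0 subrr oppr0.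
  rewrite xmul_level0 // opprD addrC; congr (_ + _).
  rewrite -[RHS]mulrNz; congr (_ *~ _).
  by case: (col u) (col w) cuw => [] [].
by rewrite {1}/level raddfMn /= xmul_mono uW mul0rn sub0r addr0.
Qed.

(** Both x_u and x_w send the alternating sum to x_W, with the signs of [u] and
    [w]; as these are opposite, the difference is twice a monomial. *)
Lemma diff_level_old u w W k : u \in W -> w \in W -> col w != col u ->
  pm_eq (xmul u (level W k) - xmul w (level W k)) (level W k.+1).
Proof.
move=> uW wW cuw; case: k => [|[|k]]; last first.
- by left; rewrite /level (raddf0 (xmul u)) (raddf0 (xmul w)) subrr.
- by left; rewrite /level (raddfMn (xmul u)) (raddfMn (xmul w)) /= !xmul_mono uW wW subrr.
rewrite !xmul_level0 // -mulrzBr /level.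
by case: (col u) (col w) cuw => [] [] //= _; [right | left];
  rewrite expr0 expr1 ?mulrNz.
Qed.

Hypothesis ends_in : forall e, e \in edges G ->
  (end1 G e \in verts G) && (end2 G e \in verts G).
Hypothesis col_proper : forall e, e \in edges G ->
  col (end1 G e) != col (end2 G e).

Lemma edge_diff_level_new e W k : e \in edges G ->
  (end1 G e \in W) != (end2 G e \in W) ->
  pm_eq (edge_diff e (level W k)) (level (end1 G e |: (end2 G e |: W)) k).
Proof.
move=> eG; rewrite /edge_diff; have := col_proper eG.
move: (end1 G e) (end2 G e) => u w cuw.
have absorb x : x \in W -> x |: W = W.
  by move=> xW; apply/setUidPr; rewrite sub1set.
case uW: (u \in W); case wW: (w \in W) => // _.
  rewrite diff_level_new ?wW 1?eq_sym //; right.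
  by rewrite setUCA (absorb u uW).
by rewrite -opprB diff_level_new ?uW // opprK (absorb w wW); left.
Qed.

Lemma edge_diff_level_old e W k : e \in edges G ->
  end1 G e \in W -> end2 G e \in W ->
  pm_eq (edge_diff e (level W k)) (level W k.+1).
Proof. by move=> eG uW wW; apply: diff_level_old; rewrite // eq_sym col_proper. Qed.

Hypothesis conn : graph_connected G.

(** The graph can keep growing: a connected graph has an edge leaving any
    nonempty proper set of vertices. *)
Lemma crossing_edge W : W != set0 -> W \proper verts G ->
  exists2 e, e \in edges G & (end1 G e \in W) != (end2 G e \in W).
Proof.
case/set0Pn => v vW /properP[/subsetP sWV [w wV wW]].
apply/exists_inP; apply: contraNT wW => /exists_inPn no.
have cl : closed (adjacent G) (mem W).
  move=> x y /exists_inP[e /no]; rewrite negbK => /eqP same.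
  by case/orP=> /andP[/eqP <- /eqP <-].
by rewrite -(closed_connect cl (conn (sWV v vW) wV)).
Qed.

(** The growth induction.  [W] and [k] describe the part of the graph already
    multiplied out, and [s] lists the edges still to be used; all edges leaving
    [W] are among them, so [crossing_edge] provides the next one. *)
Lemma edge_prod_level s W k :
  uniq s -> {subset s <= edges G} -> W != set0 -> W \subset verts G ->
  (forall e, e \in edges G -> e \notin s ->
     (end1 G e \in W) && (end2 G e \in W)) ->
  exists j, (j + #|verts G| = k + size s + #|W|)%N /\
    pm_eq (edge_prod s (level W k)) (level (verts G) j).
Proof.
have [n] := ubnP (size s); elim: n s W k => // n IH s W k.
rewrite ltnS => sn us sG W0 WV rest.
(* Multiplying by [e] leads to the situation [W'], [k'] with one edge less. *)
have step e W' k' : e \in s -> pm_eq (edge_diff e (level W k)) (level W' k') ->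
    W \subset W' -> end1 G e \in W' -> end2 G e \in W' -> W' \subset verts G ->
    (k' + #|W'| = (k + #|W|).+1)%N ->
    exists j, (j + #|verts G| = k + size s + #|W|)%N /\
      pm_eq (edge_prod s (level W k)) (level (verts G) j).
  move=> es pW sWW' e1 e2 W'V card.
  have ss : size s = (size (rem e s)).+1 by rewrite size_rem // prednK //; case: (s) es.
  have [||||||j [jE jP]] := IH (rem e s) W' k'.
  - by rewrite -ss.
  - exact: rem_uniq.
  - by move=> x /mem_rem /sG.
  - by case/set0Pn: W0 => x xW; apply/set0Pn; exists x; apply: subsetP xW.
  - by [].
  - move=> x xG; rewrite mem_rem_uniq // inE negb_and negbK.
    case/orP=> [/eqP -> | xs]; first by rewrite e1.
    by have /andP[/(subsetP sWW') -> /(subsetP sWW') ->] := rest x xG xs.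
  exists j; split; first by rewrite jE ss addnAC card addSn addnS addSn addnAC.
  rewrite (perm_edge_prod _ (perm_to_rem es)) /=.
  exact: pm_eq_trans (pm_edge_prod _ pW) jP.
(* Once all vertices are reached, any remaining edge closes a cycle. *)
have [VW|nVW] := boolP (verts G \subset W).
  have {VW} EW : W = verts G by apply/eqP; rewrite eqEsubset WV.
  case: s => [|e s] in sn us sG rest step *.
    by exists k; rewrite addn0 -EW; split=> //; apply: pm_eq_refl.
  have eG := sG e (mem_head e s).
  have /andP[e1 e2] := ends_in eG.
  apply: (step e W k.+1); rewrite ?mem_head // ?EW //.
  exact: edge_diff_level_old.
have [||e eG ee] := @crossing_edge W; rewrite // ?properE ?WV //.
have es : e \in s.
  by apply: contraR ee => /(rest e eG)/andP[-> ->].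
have /andP[e1 e2] := ends_in eG.
apply: (step e (end1 G e |: (end2 G e |: W)) k); rewrite ?setU11 //.
- exact: edge_diff_level_new.
- by rewrite setUA subsetUr.
- by rewrite !inE eqxx orbT.
- by rewrite !subUset !sub1set e1 e2 WV.
rewrite !cardsU1 !inE -addnS; congr (_ + _)%N.
move: ee (col_proper eG).
have [->|_] := eqVneq (end1 G e) (end2 G e); first by rewrite eqxx.
by case: (end1 G e \in W); case: (end2 G e \in W).
Qed.

Lemma edge_prod_connected s v : v \in verts G -> perm_eq s (enum (edges G)) ->
  exists j, (j + #|verts G| = #|edges G|.+1)%N /\
    pm_eq (edge_prod s (mono set0)) (level (verts G) j).
Proof.
move=> vG sE; have sG e : (e \in s) = (e \in edges G).
  by rewrite (perm_mem sE) mem_enum.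
have [|||||j [jE jP]] := @edge_prod_level s [set v] 0.
- by rewrite (perm_uniq sE) enum_uniq.
- by move=> e; rewrite sG.
- by apply/set0Pn; exists v; rewrite set11.
- by rewrite sub1set.
- by move=> e eG; rewrite sG eG.
exists j; split; first by rewrite jE cards1 addn1 (perm_size sE) -cardE.
apply: pm_eq_trans jP; apply/pm_edge_prod/pm_eq_sym.
by rewrite /level big_set1 setDv; apply: pm_eq_sign.
Qed.

End EdgeProducts.

(** * Coboundaries and distances in graphs *)

Section Coboundary.
Variables (V E : finType) (G : multigraph V E).

Lemma coboundary_sum (h : V -> rat) (j : 'I_#|edges G|) :
  end1 G (enum_val j) \in verts G -> end2 G (enum_val j) \in verts G ->
  \sum_i h (enum_val i) * coboundary G i j =
    h (end2 G (enum_val j)) - h (end1 G (enum_val j)).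
Proof.
have sel v : v \in verts G ->
    \sum_(i : 'I_#|verts G|) h (enum_val i) * (v == enum_val i)%:R = h v.
  move=> vG; rewrite (bigD1 (enum_rank_in vG v)) //= enum_rankK_in // eqxx mulr1.
  rewrite big1 ?addr0 // => i ni; case: (v =P _) => [vi|_]; last by rewrite mulr0.
  by case/eqP: ni; apply: enum_val_inj; rewrite enum_rankK_in.
move=> e1 e2; rewrite -(sel _ e1) -(sel _ e2) -sumrB.
by apply: eq_bigr => i _; rewrite mxE mulrBr.
Qed.

Hypothesis ends_in : forall e, e \in edges G ->
  (end1 G e \in verts G) && (end2 G e \in verts G).

(** The left kernel of the coboundary consists of the functions on vertices that
    agree at the ends of every edge.  If these factor through [q], each of them
    is a combination of the indicators of the fibers of [q], which bounds the
    dimension of the kernel.  For suitable [q] this counts components, both in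
    [Gamma0 D] and in the map of the diagram. *)
Lemma coboundary_rank_ge (R : finType) (q : V -> R) :
  (forall h : V -> rat,
     (forall e, e \in edges G -> h (end1 G e) = h (end2 G e)) ->
     {in verts G &, forall v w, q v = q w -> h v = h w}) ->
  (#|verts G| <= \rank (coboundary G) + #|q @: verts G|)%N.
Proof.
move=> const; rewrite -leq_subLR -mxrank_ker.
set K := kermx _; set Q := q @: verts G.
pose B : 'M[rat]_(#|Q|, #|verts G|) :=
  \matrix_(k, i) (q (enum_val i) == enum_val k)%:R.
suffices sKB : (K <= B)%MS.
  exact: leq_trans (mxrankS sKB) (rank_leq_row B).
apply/row_subP => r; set u := row r K.
have uC : u *m coboundary G = 0.
  by apply/sub_kermxP; rewrite row_sub.
have [V0 | [v0 v0V]] := set_0Vmem (verts G).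
  suffices -> : u = 0 by apply: sub0mx.
  by apply/rowP => i; have := enum_valP i; rewrite {2}V0 inE.
pose h v := u 0 (enum_rank_in v0V v).
have hE i : h (enum_val i) = u 0 i by rewrite /h enum_valK_in.
have hconst e : e \in edges G -> h (end1 G e) = h (end2 G e).
  move=> eG; have /andP[e1 e2] := ends_in eG.
  have eK : enum_val (enum_rank_in eG e) = e by rewrite enum_rankK_in.
  have := @coboundary_sum h (enum_rank_in eG e); rewrite eK => /(_ e1 e2).
  move=> dh; apply/esym/eqP; rewrite -subr_eq0 -dh; apply/eqP.
  have /rowP/(_ (enum_rank_in eG e)) := uC; rewrite mxE [RHS]mxE => uCe.
  by rewrite -[RHS]uCe; apply: eq_bigr => i _; rewrite hE.
(* The coordinates of [u] are its values at one vertex of each fiber. *)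
pose w := \row_(k < #|Q|) h (odflt v0 [pick v in verts G | q v == enum_val k]).
apply/submxP; exists w; apply/rowP => i; rewrite -hE mxE.
have iQ : q (enum_val i) \in Q by rewrite imset_f ?enum_valP.
rewrite (bigD1 (enum_rank_in iQ (q (enum_val i)))) //= big1 => [|k kn].
  rewrite !mxE enum_rankK_in // eqxx mulr1 addr0.
  case: pickP => [v /andP[vV /eqP qv]|/(_ (enum_val i))] /=.
    by rewrite (const h hconst v (enum_val i)) ?enum_valP.
  by rewrite enum_valP eqxx.
rewrite !mxE; case: eqP => [qk|]; last by rewrite mulr0.
by case/eqP: kn; apply: enum_val_inj; rewrite enum_rankK_in.
Qed.

Hypothesis conn : graph_connected G.

Lemma connected_const (h : V -> rat) :
  (forall e, e \in edges G -> h (end1 G e) = h (end2 G e)) ->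
  {in verts G &, forall v w, h v = h w}.
Proof.
move=> hE v w vG wG.
have cl : closed (adjacent G) [pred x | h x == h v].
  move=> x y /exists_inP[e /hE he]; rewrite !inE.
  by case/orP=> /andP[/eqP <- /eqP <-]; rewrite he.
by have := closed_connect cl (conn vG wG); rewrite !inE eqxx => /esym/eqP.
Qed.

Lemma betti1_connected v : v \in verts G ->
  (betti1 G + #|verts G| = #|edges G|.+1)%N.
Proof.
move=> vG.
(* The kernel of the coboundary is the line of constant functions. *)
have ge : (#|verts G| <= (\rank (coboundary G)).+1)%N.
  have := @coboundary_rank_ge unit (fun=> tt).
  rewrite -[(\rank _).+1]addn1 => /(_ _)/leq_trans -> //.
    by move=> h /connected_const hE x y xG yG _; apply: hE.
  by rewrite leq_add2l (leq_trans (max_card _)) // card_unit.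
have lt : (\rank (coboundary G) < #|verts G|)%N.
  rewrite ltn_neqAle rank_leq_row andbT.
  apply/negP => free.
  have : const_mx 1 = 0 :> 'rV[rat]_#|verts G|.
    apply: (row_free_inj free); rewrite mul0mx; apply/rowP => j; rewrite !mxE.
    have /andP[e1 e2] := ends_in (enum_valP j).
    rewrite -[RHS](subrr 1) -(coboundary_sum (fun=> 1) e1 e2).
    by apply: eq_bigr => i _; rewrite !mxE.
  move/rowP/(_ (enum_rank_in vG v)); rewrite !mxE => /eqP.
  by rewrite oner_eq0.
move: ge lt (rank_leq_col (coboundary G)); rewrite /betti1.
by move: (\rank _) => r; move: #|verts G| #|edges G| => n k; lia.
Qed.

(** Every walk changes colour at each step, so its length has the parity given by
    the colours of its ends.  Connectedness makes the search in [distance]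
    succeed: a shortest walk has no repeated vertex, hence fewer steps than there
    are elements of [V]. *)
Lemma distance_parity (col : V -> bool) v w :
  (forall e, e \in edges G -> col (end1 G e) != col (end2 G e)) ->
  v \in verts G -> w \in verts G ->
  odd (distance G v w) = col v (+) col w.
Proof.
move=> proper vG wG.
have parity p x : path (adjacent G) x p -> odd (size p) = col x (+) col (last x p).
  elim: p x => [|y p IH] x /=; first by rewrite addbb.
  case/andP=> /exists_inP[e /proper ce xy] /IH ->.
  have cxy : col x != col y.
    by case/orP: xy ce => /andP[/eqP <- /eqP <-] //; rewrite eq_sym.
  by case: (col x) (col y) cxy => [] [] //=; case: (col _).
set P := fun n => [exists p : n.-tuple V, path (adjacent G) v p && (last v p == w)].
have hasP : has P (iota 0 #|V|).
  have /connectP[p pp wl] := conn vG wG.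
  case/shortenP: pp wl => p' pp' up' _ wl.
  apply/hasP; exists (size p').
    by rewrite mem_iota add0n /= -[(size p').+1]/(size (v :: p'))
      -(card_uniqP up') max_card.
  by apply/existsP; exists (in_tuple p'); rewrite pp' wl /=.
have := nth_find 0%N hasP; move: (hasP); rewrite has_find size_iota.
rewrite -/(distance G v w) => lt; rewrite nth_iota // add0n => /existsP[p].
by case/andP=> /parity; rewrite size_tuple => -> /eqP ->.
Qed.

End Coboundary.

(** * The Alexander numbering of a planar diagram *)

Lemma froot_eq (T : finType) (f : T -> T) : injective f ->
  forall x, froot f (f x) = froot f x.
Proof.
move=> injf x; apply/eqP; rewrite eq_sym root_connect ?fconnect1 //.
exact: fconnect_sym.
Qed.

Section Alexander.
Variables (A C : finType) (D : diagram A C).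
Hypothesis wf : well_formed D.

Let next_arc a : a \in arcs D -> next D a \in arcs D.
Proof. by case: wf => H _ _ _ _; apply: H. Qed.

Let lft_arc c : c \in crossings D -> lft D c \in arcs D.
Proof. by case: wf => _ H _ _ _ /H[]. Qed.

Let rgt_arc c : c \in crossings D -> rgt D c \in arcs D.
Proof. by case: wf => _ H _ _ _ /H[]. Qed.

Lemma next_arcsE a : (next D a \in arcs D) = (a \in arcs D).
Proof.
have cl : fclosed (next D) (mem (arcs D)).
  apply: intro_closed; first exact/fconnect_sym/perm_inj.
  by move=> x y /eqP <-; apply: next_arc.
by rewrite -(fclosed1 cl).
Qed.

Variant arc_end_spec a : Prop :=
| LeftEnd c of c \in crossings D & a = lft D c
| RightEnd c of c \in crossings D & a = rgt D c
| MarkedEnd of (forall c, c \in crossings D -> lft D c != a)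
             & (forall c, c \in crossings D -> rgt D c != a).

Lemma arc_endP a : arc_end_spec a.
Proof.
case: (pickP [pred c in crossings D | lft D c == a]) => [c /andP[cD /eqP <-]|nl].
  exact: (LeftEnd cD).
case: (pickP [pred c in crossings D | rgt D c == a]) => [c /andP[cD /eqP <-]|nr].
  exact: (RightEnd cD).
by constructor=> c cD; [have := nl c | have := nr c]; rewrite /= cD /= => ->.
Qed.

Lemma node_lft c : c \in crossings D -> node D (lft D c, true) = (rgt D c, true).
Proof.
move=> cD; rewrite /node /=; case: pickP => [c' /andP[c'D /eqP E]|/(_ c)].
  by case: wf => _ _ inj _ _; rewrite (inj c' c).
by rewrite cD eqxx.
Qed.

Lemma node_rgt c : c \in crossings D ->
  node D (rgt D c, true) = (next D (rgt D c), false).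
Proof.
move=> cD; rewrite /node /=; case: pickP => // c' /andP[c'D /eqP E].
by case: wf => _ _ _ _ /(_ c' c c'D cD); rewrite E eqxx.
Qed.

Lemma node_next_rgt c : c \in crossings D ->
  node D (next D (rgt D c), false) = (next D (lft D c), false).
Proof.
move=> cD; rewrite /node /= permK; case: pickP => [c' /andP[c'D /eqP E]|/(_ c)].
  by case: wf => _ _ _ inj _; rewrite (inj c' c).
by rewrite cD eqxx.
Qed.

Lemma node_next_lft c : c \in crossings D ->
  node D (next D (lft D c), false) = (lft D c, true).
Proof.
move=> cD; rewrite /node /= permK; case: pickP => // c' /andP[c'D /eqP E].
by case: wf => _ _ _ _ /(_ c c' cD c'D); rewrite E eqxx.
Qed.

Lemma node_marked a : (forall c, c \in crossings D -> lft D c != a) ->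
  node D (a, true) = (next D a, false).
Proof.
move=> nl; rewrite /node /=; case: pickP => // c /andP[cD /eqP E].
by have := nl c cD; rewrite E eqxx.
Qed.

Lemma node_next_marked a : (forall c, c \in crossings D -> rgt D c != a) ->
  node D (next D a, false) = (a, true).
Proof.
move=> nr; rewrite /node /= permK; case: pickP => // c /andP[cD /eqP E].
by have := nr c cD; rewrite E eqxx.
Qed.

(** Vertices have degree 4 or 2, so the fourth power of [node] is the identity;
    injectivity follows. *)
Lemma node_iter4 d : iter 4 (node D) d = d.
Proof.
have main a : iter 4 (node D) (a, true) = (a, true)
    /\ iter 4 (node D) (next D a, false) = (next D a, false).
  have [c cD ->|c cD ->|nl nr] := arc_endP a; rewrite /=;
  by rewrite ?(node_lft, node_rgt, node_next_rgt, node_next_lft)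
             ?(node_marked, node_next_marked).
case: d => a [] ; first by case: (main a).
by have [_] := main ((next D)^-1%g a); rewrite permKV.
Qed.

Lemma node_inj : injective (node D).
Proof. by apply: (can_inj (g := iter 3 (node D))) => d; apply: node_iter4. Qed.

Lemma edgeK : involutive (@edge A).
Proof. by case=> a b; rewrite /edge /= negbK. Qed.

Lemma face_inj : injective (face D).
Proof. by move=> d d' /node_inj /(inv_inj edgeK). Qed.

Lemma edge_darts d : (edge d \in darts D) = (d \in darts D).
Proof. by rewrite !inE. Qed.

Lemma node_darts d : (node D d \in darts D) = (d \in darts D).
Proof.
have main a : (node D (a, true) \in darts D) = (a \in arcs D)
    /\ (node D (next D a, false) \in darts D) = (a \in arcs D).
  have [c cD ->|c cD ->|nl nr] := arc_endP a;
  rewrite ?(node_lft, node_rgt, node_next_rgt, node_next_lft)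
          ?(node_marked, node_next_marked) // !inE /=;
  by rewrite ?next_arcsE ?lft_arc ?rgt_arc.
case: d => a []; first by rewrite (main a).1 inE.
by have [_] := main ((next D)^-1%g a); rewrite permKV -next_arcsE permKV => ->; rewrite inE.
Qed.

Lemma face_darts d : (face D d \in darts D) = (d \in darts D).
Proof. by rewrite node_darts edge_darts. Qed.

Lemma froot_darts f : (forall d, (f d \in darts D) = (d \in darts D)) ->
  forall d, (froot f d \in darts D) = (d \in darts D).
Proof.
move=> fD d; have cl : fclosed f (mem (darts D)) by move=> x y /eqP <-.
by rewrite -(closed_connect cl (connect_root _ d)).
Qed.

Lemma glink_sym : connect_sym (glink D).
Proof.
have sub x y : glink D x y -> connect (glink D) y x.
  case/orP=> /eqP ->; first by apply/connect1/orP; left; rewrite edgeK.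
  have: fconnect (node D) (node D x) x.
    by rewrite fconnect_sym ?fconnect1 //; apply: node_inj.
  by apply: connect_sub => a b /eqP <-; apply/connect1/orP; right.
suffices rev x y : connect (glink D) x y -> connect (glink D) y x.
  by move=> x y; apply/idP/idP; apply: rev.
case/connectP=> p; elim: p x => [|z p IH] x /=; first by move=> _ ->.
by case/andP=> /sub zx /IH yz /yz; move/connect_trans; apply.
Qed.

(** For [node] this is the 1-skeleton of the map of the diagram, and for [face]
    its dual graph.  The vertices are the orbits, given by their roots, and both
    graphs have the arcs as edges, which lets their coboundaries be compared. *)
Definition orbit_graph (f : A * bool -> A * bool) : multigraph (A * bool)%type A :=
  Multigraph [set d in darts D | froots f d] (arcs D)
    (fun a => froot f (a, true)) (fun a => froot f (a, false)).

Section Orbits.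
Variable f : A * bool -> A * bool.
Hypotheses (f_inj : injective f)
  (f_darts : forall d, (f d \in darts D) = (d \in darts D)).

Lemma froot_orbit_graph d : d \in darts D -> froot f d \in verts (orbit_graph f).
Proof.
by move=> dD; rewrite inE froot_darts // dD roots_root //; apply: fconnect_sym.
Qed.

Lemma orbit_graph_ends a : a \in edges (orbit_graph f) ->
  (end1 (orbit_graph f) a \in verts (orbit_graph f))
  && (end2 (orbit_graph f) a \in verts (orbit_graph f)).
Proof. by move=> aD; rewrite !froot_orbit_graph ?inE. Qed.

Lemma card_orbit_graph : #|verts (orbit_graph f)| = fcard f (darts D).
Proof. by apply: eq_card => d; rewrite !inE andbC. Qed.

(** A function on the orbits of [f] which agrees at both ends of every arc is
    invariant under [f] and [edge].  For [f] equal to [node] or [face] these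
    generate all of [glink], so the function is constant on the components of the
    diagram. *)
Lemma orbit_graph_rank :
  (forall h : A * bool -> rat,
     (forall d, d \in darts D -> h (f d) = h d) ->
     (forall d, d \in darts D -> h (edge d) = h d) ->
     forall d, d \in darts D -> h (node D d) = h d) ->
  (fcard f (darts D) <=
     \rank (coboundary (orbit_graph f)) + n_comp (glink D) (darts D))%N.
Proof.
move=> gen; rewrite -card_orbit_graph.
have glinkD : closed (glink D) (mem (darts D)).
  by move=> x y /orP[] /eqP ->; rewrite ?edge_darts ?node_darts.
have := @coboundary_rank_ge _ _ (orbit_graph f) orbit_graph_ends _ (fingraph.root (glink D)).
move=> /(_ _) /leq_trans -> //; last first.
  rewrite leq_add2l; apply/subset_leq_card/subsetP => r /imsetP[d]; rewrite inE.
  case/andP=> dD _ ->; rewrite inE [X in X && _]roots_root //; last exact: glink_sym.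
  by rewrite [X in is_true X]/= -(closed_connect glinkD (connect_root _ d)).
move=> h hE; pose h' d := h (froot f d).
have h'f d : d \in darts D -> h' (f d) = h' d by rewrite /h' froot_eq.
have h'e d : d \in darts D -> h' (edge d) = h' d.
  by case: d => a []; rewrite inE => /hE /= ; rewrite /h' /edge /= => ->.
have h'n := gen h' h'f h'e.
have cst d d' : connect (glink D) d d' -> d \in darts D -> h' d = h' d'.
  case/connectP=> p; elim: p d => [|x p IH] d /=; first by move=> _ ->.
  case/andP=> dx xp l dD; rewrite -(IH x) -?(glinkD _ _ dx) //.
  by case/orP: dx => /eqP ->; rewrite ?h'e ?h'n.
move=> d d' /setIdP[dD rd] /setIdP[d'D rd'] /eqP.
rewrite root_connect; last exact: glink_sym.
by move=> /cst /(_ dD); rewrite /h' (eqP rd) (eqP rd').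
Qed.

End Orbits.

Lemma sum_darts (F : A * bool -> rat) :
  \sum_(a in arcs D) (F (a, false) + F (a, true)) = \sum_(d in darts D) F d.
Proof.
transitivity (\sum_(a in arcs D) \sum_(b : bool) F (a, b)).
  by apply: eq_bigr => a _; rewrite big_bool addrC.
rewrite pair_big; apply: eq_big => [d|[a b]] //=.
by rewrite andbT inE.
Qed.

Lemma reindex_darts (F : A * bool -> rat) (f : A * bool -> A * bool) :
  injective f -> (forall d, (f d \in darts D) = (d \in darts D)) ->
  \sum_(d in darts D) F d = \sum_(d in darts D) F (f d).
Proof.
by move=> f_inj fD; rewrite (reindex_inj f_inj) /=; apply: eq_bigl => d.
Qed.

(** Boundaries of faces are cycles.  With F and N the indicators of a face and of
    a vertex, the entry is the sum over darts d of F(d) N(d) - F(d) N(edge d);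
    after d = edge e in the second term, F(edge e) = F(face (edge e)) = F(node e)
    and N(e) = N(node e), so that both terms have the same sum. *)
Lemma dual_coboundary_orthogonal :
  coboundary (orbit_graph (face D)) *m (coboundary (orbit_graph (node D)))^T = 0.
Proof.
apply/matrixP => i j; rewrite !mxE.
set x := enum_val i; set y := enum_val j.
pose F d : rat := (froot (face D) d == x)%:R.
pose N d : rat := (froot (node D) d == y)%:R.
transitivity (\sum_(a in arcs D) (F (a, false) - F (a, true)) * (N (a, false) - N (a, true))).
  rewrite [RHS]big_enum_val /=.
  by apply: eq_bigr => a _; rewrite !mxE.
transitivity (\sum_(d in darts D) F d * (N d - N (edge d))).
  rewrite -sum_darts; apply: eq_bigr => a _; rewrite /edge /= -/N.
  by rewrite mulrBl -[in X in _ - X]opprB mulrN opprK.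
under eq_bigr do rewrite mulrBr; rewrite sumrB; apply/eqP; rewrite subr_eq0; apply/eqP.
rewrite (reindex_darts _ node_inj node_darts).
rewrite [RHS](reindex_darts _ (inv_inj edgeK) edge_darts).
apply: eq_bigr => d _; rewrite edgeK; congr (_ * _).
  by rewrite /F -(froot_eq face_inj (edge d)) /face edgeK.
by rewrite /N froot_eq //; apply: node_inj.
Qed.

(** Every vertex has as many incoming as outgoing arcs: the head of [a] and the
    tail of [next D a] are the same vertex. *)
Lemma balanced_vertices :
  const_mx 1 *m (coboundary (orbit_graph (node D)))^T = 0 :> 'rV[rat]__.
Proof.
apply/rowP => j; rewrite !mxE; set y := enum_val j.
pose N d : rat := (froot (node D) d == y)%:R.
transitivity (\sum_(a in arcs D) (N (a, false) - N (a, true))).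
  rewrite [RHS]big_enum_val /=.
  by apply: eq_bigr => a _; rewrite !mxE mul1r.
rewrite sumrB [X in X - _](reindex_inj (@perm_inj _ (next D))) /=.
rewrite (eq_bigl (mem (arcs D))); last by move=> a; rewrite next_arcsE.
apply/eqP; rewrite subr_eq0; apply/eqP/eq_bigr => a _.
have Nn d : N (node D d) = N d by rewrite /N froot_eq //; apply: node_inj.
have [c cD ->|c cD ->|nl _] := arc_endP a.
- by rewrite -(node_next_rgt cD) Nn -node_rgt // Nn -node_lft // Nn.
- by rewrite -node_rgt // Nn.
by rewrite -node_marked // Nn.
Qed.

Lemma card_darts : #|darts D| = #|arcs D|.*2.
Proof.
rewrite -muln2 -card_bool -cardsT -cardsX.
by apply: eq_card => d; rewrite !inE andbT.
Qed.

Lemma fcard_edge_darts : (fcard (@edge A) (darts D) <= #|arcs D|)%N.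
Proof.
rewrite /n_comp_mem -(card_in_image (f := fst)).
  apply/subset_leq_card/subsetP => a /imageP[d].
  by case/andP=> _ dD ->; have : d \in darts D := dD; rewrite inE.
move=> [a b] [a' b'] /andP[r _] /andP[r' _] /= aa'; case: _ / aa' in r' *.
have [-> //|bb'] := eqVneq b b'.
rewrite -(eqP r) -(eqP r'); apply/eqP; rewrite root_connect; last first.
  by apply/fconnect_sym/inv_inj/edgeK.
rewrite (_ : (a, b') = edge (a, b)) ?fconnect1 // /edge /=.
by case: b b' bb' {r r'} => [] [].
Qed.

Hypothesis pl : planar D.

(** Orthogonality gives one inclusion between the row space of the coboundary of
    the dual graph and the cycles of the 1-skeleton; Euler's formula makes the
    dimensions equal.  The sum of all arcs is a cycle, hence a coboundary. *)
Lemma alexander_numbering :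
  exists f : A * bool -> rat, (forall d, f (face D d) = f d)
    /\ {in arcs D, forall a, f (a, false) = f (a, true) + 1}.
Proof.
set CF := coboundary (orbit_graph (face D)).
set CN := coboundary (orbit_graph (node D)).
have rF : (fcard (face D) (darts D) <= \rank CF + n_comp (glink D) (darts D))%N.
  apply: orbit_graph_rank; [exact: face_inj | exact: face_darts |].
  move=> h hf he d dD; rewrite -[d in LHS]edgeK -/(face D (edge d)).
  by rewrite hf ?edge_darts // he.
have rN : (fcard (node D) (darts D) <= \rank CN + n_comp (glink D) (darts D))%N.
  by apply: orbit_graph_rank; [exact: node_inj | exact: node_darts |].
have sub : (CF <= kermx CN^T)%MS by apply/sub_kermxP/dual_coboundary_orthogonal.
have ker : (kermx CN^T <= CF)%MS.
  (* F - k and V - k bound the two ranks from below, and by Euler's formula they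
     add up to the number of arcs. *)
  rewrite -(geq_leqif (mxrank_leqif_sup sub)) mxrank_ker mxrank_tr.
  move: pl rF rN fcard_edge_darts; rewrite /planar card_darts.
  move: (fcard (face D) _) (fcard (node D) _) (fcard (@edge A) _).
  move: (n_comp _ _) (\rank CF) (\rank CN) => k rF rN f n e.
  by move: #|arcs D| => m; rewrite /edges /=; lia.
have /submxP[u uE] : ((const_mx 1 : 'rV[rat]_#|arcs D|) <= CF)%MS.
  by apply: submx_trans ker; apply/sub_kermxP/balanced_vertices.
have [D0|[a0 a0D]] := set_0Vmem (arcs D).
  by exists (fun=> 0); split=> // a; rewrite D0 inE.
have v0 : froot (face D) (a0, true) \in verts (orbit_graph (face D)).
  by apply: froot_orbit_graph; rewrite ?inE //; [exact: face_inj | exact: face_darts].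
pose h v := u 0 (enum_rank_in v0 v).
exists (fun d => h (froot (face D) d)); split=> [d|a aD].
  by rewrite froot_eq //; apply: face_inj.
have ends := orbit_graph_ends face_inj face_darts aD.
have := @coboundary_sum _ _ (orbit_graph (face D)) h (enum_rank_in aD a).
rewrite enum_rankK_in //; case/andP: ends => e1 e2 /(_ e1 e2) /= dh.
apply/eqP; rewrite addrC -subr_eq -dh; apply/eqP.
have /rowP/(_ (enum_rank_in aD a)) := uE; rewrite mxE [RHS]mxE => ->.
by apply: eq_bigr => i _; rewrite /h enum_valK_in.
Qed.

(** The face on the left of the arc [a] is the one containing the dart
    [(a, true)]. *)
Lemma seifert_heights :
  exists g : A -> rat, {in arcs D, forall a, g (next D a) = g a}
    /\ {in crossings D, forall c, g (rgt D c) = g (lft D c) + 1}.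
Proof.
have [f [fF fE]] := alexander_numbering.
have fN d : f (node D d) = f (edge d) by rewrite -[RHS]fF /face edgeK.
have fC c : c \in crossings D -> f (rgt D c, true) = f (lft D c, true) + 1.
  by move=> cD; rewrite -fE ?lft_arc // -node_lft // fN.
exists (fun a => f (a, true)); split=> // a aD.
have := fN (next D a, false); rewrite [edge _]/= => <-.
have [c cD aE|c cD aE|_ nr] := arc_endP a; last by rewrite node_next_marked.
  by rewrite aE node_next_lft.
rewrite aE node_next_rgt // fE ?next_arc ?lft_arc // fC //.
have := fN (next D (lft D c), false); rewrite node_next_lft // [edge _]/=.
by move=> ->.
Qed.

End Alexander.

(** * Chain maps on oriented smoothings *)

(** In the states met by the movie no crossing is turned, so that the circles
    are the orbits of [next]. *)
Section Oriented.
Variables (A C : finType) (X : diagram A C) (s : {set C}).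
Hypothesis oriented : forall c, c \in crossings X -> ~~ turned X s c.

Lemma glued_oriented a b : glued X s a b = (b == next X a).
Proof.
rewrite /glued; case: exists_inP => [[c /oriented]|_].
  by rewrite -[turned _ _ _ && _]/(andb _ _); case: turned.
rewrite andbT; case: exists_inP => [[c /oriented]|_]; last by rewrite orbF.
by case: turned.
Qed.

Lemma circle_oriented a b : (b \in circle X s a) = fconnect (next X) a b.
Proof.
rewrite inE; apply/idP/idP; apply: connect_sub => x y.
  rewrite /= !glued_oriented => /orP[] /eqP ->; first exact: fconnect1.
  by rewrite fconnect_sym ?fconnect1 //; apply: perm_inj.
by move/eqP <-; apply: connect1; rewrite /= glued_oriented eqxx.
Qed.

Lemma is_enhanced_oriented (l : {set A}) :
  s \subset crossings X -> l \subset arcs X ->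
  {in l, forall a, next X a \in l} -> is_enhanced X (s, l).
Proof.
move=> sX lX lN; rewrite /is_enhanced /= sX lX /=.
apply/forall_inP => a al; apply/subsetP => b; rewrite circle_oriented.
move=> ab; suffices cl : fclosed (next X) (mem l) by rewrite -(closed_connect cl ab).
apply: intro_closed; first exact/fconnect_sym/perm_inj.
by move=> x y /eqP <-; apply: lN.
Qed.

End Oriented.

Section Lin.
Variables (A C A' C' : finType) (X : diagram A C) (Y : diagram A' C').
Variable f : {set C} -> {set A} -> CKh Y.

Lemma lin_is_zmod_morphism : zmod_morphism (lin (X := X) f).
Proof.
move=> y z; rewrite /lin -sumrB; apply: eq_bigr => e _.
by rewrite !ffunE mulrzBr.
Qed.
HB.instance Definition _ := GRing.isZmodMorphism.Build (CKh X) (CKh Y)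
  (lin (X := X) f) lin_is_zmod_morphism.

Lemma linB y z : lin f (y - z) = lin f y - lin (X := X) f z.
Proof. exact: raddfB. Qed.

Lemma lin0 : lin f (0 : CKh X) = 0.
Proof. exact: raddf0. Qed.

Lemma lin_sum (I : finType) (P : pred I) (z : I -> CKh X) (n : I -> int) :
  lin f (\sum_(i | P i) z i *~ n i) = \sum_(i | P i) lin f (z i) *~ n i.
Proof. by rewrite raddf_sum; apply: eq_bigr => i _; rewrite raddfMz. Qed.

Lemma lin_kgen s l : is_enhanced X (s, l) -> lin f (kgen X s l) = f s l.
Proof.
move=> en; rewrite /lin (bigD1 (Sub (s, l) en : enhanced X)) //= ffunE.
rewrite eqxx mulr1z big1 ?addr0 // => e /negPf ne; rewrite ffunE.
by rewrite -[(s, l)]/(val (Sub (s, l) en : enhanced X)) val_eqE ne mulr0z.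
Qed.

End Lin.

Section Glue.
Variables (A C : finType) (X : diagram (option A) C) (Y : diagram A C).
Variables p q : option A.

Definition glue (z : CKh X) : CKh Y := absorb_map Y (saddle_map p q z).

Lemma glueB y z : glue (y - z) = glue y - glue z.
Proof. by rewrite /glue /absorb_map /saddle_map !linB. Qed.

Lemma glue0 : glue 0 = 0.
Proof. by rewrite /glue /saddle_map lin0; apply: lin0. Qed.

Lemma glue_sum (I : finType) (P : pred I) (z : I -> CKh X) (n : I -> int) :
  glue (\sum_(i | P i) z i *~ n i) = \sum_(i | P i) glue (z i) *~ n i.
Proof. by rewrite /glue /saddle_map lin_sum; apply: lin_sum. Qed.

End Glue.

Section TwistAndGlue.
Variables (A C : finType) (D : diagram A C).
Hypothesis wf : well_formed D.

Definition seifert_circle (a : A) : {set A} := circle D (seifert_state D) a.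

Lemma seifert_state_oriented (X : diagram A C) c :
  c \in crossings X -> ~~ turned X (seifert_state X) c.
Proof. by move=> cX; rewrite /turned inE cX; case: positive. Qed.

Lemma seifert_circleE a b : (b \in seifert_circle a) = fconnect (next D) a b.
Proof. exact/circle_oriented/seifert_state_oriented. Qed.

Lemma next_circle a b : (next D b \in seifert_circle a) = (b \in seifert_circle a).
Proof.
by rewrite !seifert_circleE -(same_fconnect1_r perm_inj).
Qed.

Lemma circle_next b : seifert_circle (next D b) = seifert_circle b.
Proof.
apply/setP => x; rewrite !seifert_circleE.
by rewrite -(same_fconnect1 perm_inj).
Qed.

Lemma circle_arcs a : a \in arcs D -> seifert_circle a \subset arcs D.
Proof.
move=> aD; apply/subsetP => b; rewrite seifert_circleE => ab.
suffices cl : fclosed (next D) (mem (arcs D)) by rewrite -(closed_connect cl ab).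
by move=> x y /eqP <-; rewrite /= next_arcsE.
Qed.

Variable P : {set C}.
Local Notation F := (frame D (arcs D)).

(** The sets of arcs which are unions of Seifert circles, that is, the labelings
    of the oriented smoothing. *)
Definition stable (l : {set A}) : Prop :=
  l \subset arcs D /\ (forall a, (next D a \in l) = (a \in l)).

Lemma stableU l a : stable l -> a \in arcs D -> stable (l :|: seifert_circle a).
Proof.
case=> lD lN aD; split; first by rewrite subUset lD circle_arcs.
by move=> b; rewrite !in_setU lN next_circle.
Qed.

Lemma stable_absorb l a : stable l -> a \in l -> l :|: seifert_circle a = l.
Proof.
case=> _ lN al; apply/setUidPl/subsetP => b; rewrite seifert_circleE => ab.
have cl : fclosed (next D) (mem l) by move=> x y /eqP <-; rewrite /= lN.
by rewrite -(closed_connect cl ab).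
Qed.

Lemma is_enhanced_frame l : stable l ->
  is_enhanced (F P) (seifert_state (F P), l).
Proof.
case=> lD lN; apply: is_enhanced_oriented => //=.
- exact: (@seifert_state_oriented (F P)).
- by apply/subsetP => c; rewrite inE => /andP[].
by move=> a; rewrite lN.
Qed.

Variables (c : C) (onleft : bool).
Hypotheses (cD : c \in crossings D) (cP : c \notin P).

Let a := if onleft then lft D c else rgt D c.
Let b := if onleft then rgt D c else lft D c.
Let K := kink (F P) c a onleft (positive D c).
Let Fc := F (c |: P).
Let s := seifert_state Fc.

Lemma foot_arcs : (a \in arcs D) && (b \in arcs D).
Proof.
by case: wf => _ /(_ c cD)[lD rD] _ _ _; rewrite /a /b; case: onleft; rewrite lD rD.
Qed.

Lemma kink_oriented c' : c' \in crossings K -> ~~ turned K s c'.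
Proof.
have posE : positive K c' = positive Fc c' by rewrite /=; case: eqP => [->|].
by rewrite /turned posE => /(@seifert_state_oriented Fc).
Qed.

Lemma next_kinkE o : next K o = omap (next D) o.
Proof. by rewrite /= /next_kink permE. Qed.

Lemma kink_circle_loop o : (o \in circle K s None) = (o == None).
Proof.
rewrite circle_oriented; last exact: kink_oriented.
apply/idP/eqP => [|->]; last exact: connect0.
by case/connectP=> p; elim: p o => [|o' p IH] o //= /andP[/eqP <-];
  rewrite permE; apply: IH.
Qed.

(** The labeling of the kinked diagram which restricts to [l] on the old circles
    and has the loop of the kink labeled x iff [x]. *)
Definition labeled (x : bool) (l : {set A}) : {set option A} :=
  [set o | if o is Some e then e \in l else x].

Lemma labeled_loop (l : {set A}) : None |: Some @: l = labeled true l.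
Proof.
apply/setP => -[e|]; rewrite !inE // mem_imset //.
by move=> x y [].
Qed.

Lemma labeled_noloop (l : {set A}) : Some @: l = labeled false l.
Proof.
apply/setP => -[e|]; rewrite inE; first by rewrite mem_imset // => x y [].
by apply/imsetP => -[].
Qed.

Lemma kink_circle_next d :
  circle K s (Some (next D d)) = labeled false (seifert_circle d).
Proof.
apply/setP => -[e|]; rewrite [RHS]in_set circle_oriented; try exact: kink_oriented.
  rewrite -circle_next seifert_circleE; apply/idP/idP.
    case/connectP=> p; elim: p (next D d) => [|o p IH] x /=.
      by move=> _ [->]; apply: connect0.
    case/andP=> /eqP <-; rewrite permE /= => /IH H /H.
    by apply: connect_trans; apply: fconnect1.
  case/connectP=> p; elim: p (next D d) => [|y p IH] x /=.
    by move=> _ ->; apply: connect0.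
  case/andP=> /eqP <- /IH H /H; apply: connect_trans; apply: connect1.
  by rewrite /= permE.
apply/negbTE; rewrite fconnect_sym; last exact: perm_inj.
by rewrite -(circle_oriented kink_oriented) kink_circle_loop.
Qed.

Definition kstable (l : {set option A}) : Prop :=
  l \subset arcs K /\ (forall o, (next K o \in l) = (o \in l)).

Lemma kstable_labeled x l : stable l -> kstable (labeled x l).
Proof.
case=> lD lN; split; last by move=> [e|]; rewrite next_kinkE /= !inE ?lN.
apply/subsetP => -[e|]; rewrite !inE //= => el.
by rewrite mem_imset ?(subsetP lD) // => y z [].
Qed.

Lemma is_enhanced_kink l : kstable l -> is_enhanced K (s, l).
Proof.
case=> lK lN; apply: is_enhanced_oriented => //=.
- exact: kink_oriented.
- by apply/subsetP => c'; rewrite inE => /andP[].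
by move=> o; rewrite lN.
Qed.

Lemma is_enhanced_glued l : kstable l -> (None \in l) = (Some b \in l) ->
  is_enhanced (saddle K None (Some (next D b))) (s, l).
Proof.
case=> lK lN lE; apply: is_enhanced_oriented => //=.
- exact: kink_oriented.
- by apply/subsetP => c'; rewrite inE => /andP[].
have qE : (Some (next D b) \in l) = (Some b \in l) by rewrite -[RHS]lN next_kinkE.
move=> o; rewrite -lN permM /=.
by case: tpermP => [-> | -> |] //; rewrite qE lE.
Qed.

(** The saddle always merges, because the loop of the kink is a circle by itself;
    merging a loop labeled x multiplies by x on the circle of [b], and merging a
    loop labeled 1 does nothing. *)
Lemma glue_kgen x l : stable l ->
  glue Fc None (Some (next D b)) (kgen K s (labeled x l)) =
    if x && (b \in l) then 0
    else if x || (b \in l) then kgen Fc s (l :|: seifert_circle b)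
    else kgen Fc s l.
Proof.
move=> lS; rewrite /glue [saddle_map _ _ _]lin_kgen; last first.
  exact/is_enhanced_kink/kstable_labeled.
have preimE y m : Some @^-1: labeled y m = m by apply/setP => e; rewrite !inE.
have [bD bb] : b \in arcs D /\ b \in seifert_circle b.
  by case/andP: foot_arcs => _ ->; rewrite seifert_circleE connect0.
rewrite kink_circle_loop kink_circle_next /= !inE lS.2.
have -> : labeled x l :|: circle K s None :|: labeled false (seifert_circle b)
    = labeled true (l :|: seifert_circle b).
  apply/setP => -[e|]; rewrite !(in_setU, kink_circle_loop) !in_set /=.
    by rewrite orbF.
  by rewrite orbT.
case xl: (x && _); first exact: lin0.
case xl': (x || _).
  rewrite [absorb_map _ _]lin_kgen ?preimE //.
  apply: is_enhanced_glued; first exact/kstable_labeled/stableU.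
  by rewrite [LHS]in_set [RHS]in_set in_setU bb orbT.
rewrite [absorb_map _ _]lin_kgen ?preimE //.
apply: is_enhanced_glued; first exact/kstable_labeled.
by rewrite [LHS]in_set [RHS]in_set; case/norP: (negbT xl') => /negPf -> /negPf ->.
Qed.

(** For a positive crossing, the two terms v.x - xv.1 of the kink become
    multiplication by x on the circle of [b] and on that of [a]. *)
Lemma twist_and_glue_kgen l : stable l ->
  twist_and_glue c onleft (kgen (F P) (seifert_state (F P)) l) =
    if positive D c then
      (if b \in l then 0 else kgen Fc s (l :|: seifert_circle b))
      - (if a \in l then 0 else kgen Fc s (l :|: seifert_circle a))
    else kgen Fc s l.
Proof.
move=> lS; rewrite /twist_and_glue -/a -/b [kink_map _ _ _ _ _]lin_kgen; last first.
  exact: is_enhanced_frame.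
have ca : circle (F P) (seifert_state (F P)) a = seifert_circle a.
  apply/setP => e; rewrite seifert_circleE circle_oriented //.
  exact: (@seifert_state_oriented (F P)).
have [aD aa] : a \in arcs D /\ a \in seifert_circle a.
  by case/andP: foot_arcs => -> _; rewrite seifert_circleE connect0.
have sP : seifert_state (F P) = s :\ c.
  apply/setP => c'; rewrite !inE /=; have [->|//] := eqVneq c' c.
  by rewrite (negPf cP).
have sE : (if positive D c then seifert_state (F P) else c |: seifert_state (F P)) = s.
  rewrite sP; case: ifP => cpos; last by rewrite setD1K // !inE eqxx /= cpos.
  by apply/setDidPl; rewrite disjoint_sym disjoints1 !inE /= cpos andbF.
rewrite ca labeled_loop !labeled_noloop.
rewrite -/(glue _ _ _ _); have glueE := glue_kgen; rewrite /K in glueE.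
case: ifP sE glueE => _ -> glueE; last first.
  by rewrite glueE //=; case: ifP => // bl; rewrite stable_absorb.
rewrite glueB glueE //=; congr (_ - _).
case: ifP => al; first exact: glue0.
have uS := stableU lS aD; rewrite glueE //=.
by case: ifP => // bu; rewrite stable_absorb.
Qed.

End TwistAndGlue.

(** * The cycle as a square-free polynomial in the Seifert circles *)

Section Realization.
Variables (A C : finType) (D : diagram A C).
Hypothesis wf : well_formed D.

Local Notation F := (frame D (arcs D)).
Local Notation sqfree := {ffun {set {set A}} -> int}.
Local Notation seifert_circles := (circles D (seifert_state D)).

Implicit Types P : {set C}.

(** Monomials containing a set of arcs that is not a Seifert circle are sent
    to 0.  The diagram [X] is [D] with some crossings left out, which has the same
    oriented smoothing. *)
Definition realize (X : diagram A C) (f : sqfree) : CKh X :=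
  \sum_(S : {set {set A}} | S \subset seifert_circles)
     kgen X (seifert_state X) (cover S) *~ f S.

Lemma realize_is_zmod_morphism X : zmod_morphism (realize X).
Proof.
move=> f g; rewrite /realize -sumrB; apply: eq_bigr => S _.
by rewrite !ffunE mulrzBr.
Qed.
HB.instance Definition _ X := GRing.isZmodMorphism.Build sqfree (CKh X)
  (realize X) (realize_is_zmod_morphism X).

Lemma realize_mono X (S : {set {set A}}) : S \subset seifert_circles ->
  realize X (mono S) = kgen X (seifert_state X) (cover S).
Proof.
move=> sS; rewrite /realize (bigD1 S) //= ffunE eqxx mulr1z big1 ?addr0 //.
by move=> T /andP[_ /negPf nT]; rewrite ffunE nT mulr0z.
Qed.

Lemma mem_cover_circles (S : {set {set A}}) a : S \subset seifert_circles ->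
  (a \in cover S) = (seifert_circle D a \in S).
Proof.
move=> sS; apply/bigcupP/idP => [[K KS aK]|KS]; last first.
  by exists (seifert_circle D a); rewrite // seifert_circleE connect0.
have /imsetP[b _ KE] := subsetP sS K KS.
suffices -> : seifert_circle D a = K by [].
move: aK; rewrite KE -/(seifert_circle D b) seifert_circleE => ba.
apply/setP => x; rewrite !seifert_circleE.
by rewrite (same_connect (fconnect_sym (@perm_inj _ (next D))) ba).
Qed.

Lemma stable_cover (S : {set {set A}}) : S \subset seifert_circles ->
  stable D (cover S).
Proof.
move=> sS; split; last by move=> a; rewrite !mem_cover_circles // circle_next.
apply/bigcupsP => K /(subsetP sS)/imsetP[b bD ->].
exact: circle_arcs.
Qed.

Lemma cover_setU1 (S : {set {set A}}) a :
  cover (seifert_circle D a |: S) = cover S :|: seifert_circle D a.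
Proof. by rewrite /cover bigcup_setU big_set1 setUC. Qed.

(** Multiplication by the variable of the circle of [a], read on chains; the sum
    is reindexed by adding that circle to the monomials without it. *)
Lemma realize_xmul X (f : sqfree) a : a \in arcs D ->
  realize X (xmul (seifert_circle D a) f) =
  \sum_(S : {set {set A}} | S \subset seifert_circles)
    (if a \in cover S then 0
     else kgen X (seifert_state X) (cover S :|: seifert_circle D a)) *~ f S.
Proof.
move=> aD; set K := seifert_circle D a.
have KD : K \in seifert_circles by apply: imset_f.
transitivity (\sum_(S : {set {set A}} | (S \subset seifert_circles) && (K \in S))
    kgen X (seifert_state X) (cover S) *~ f (S :\ K)).
  rewrite big_mkcondr; apply: eq_bigr => S _; rewrite ffunE.
  by case: ifP => // _; rewrite mulr0z.
transitivity (\sum_(S : {set {set A}} | (S \subset seifert_circles) && (K \notin S))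
    kgen X (seifert_state X) (cover S :|: K) *~ f S); last first.
  rewrite big_mkcondr; apply: eq_bigr => S sS; rewrite mem_cover_circles //.
  by case: (K \in S); rewrite /= ?mul0rz.
rewrite [LHS](reindex_onto (setU [set K]) (fun S => S :\ K)) /=; last first.
  by move=> S /andP[_ KS]; rewrite setD1K.
apply: eq_big => [S|S /andP[_ /eqP ->]]; last by rewrite cover_setU1.
rewrite setU11 andbT subUset sub1set KD /=; congr (_ && _).
by apply/eqP/idP => [<-|/setU1K //]; rewrite !inE eqxx.
Qed.

Lemma twist_and_glue_sum P c onleft (I : finType) (Q : pred I)
    (z : I -> CKh (F P)) (n : I -> int) :
  twist_and_glue c onleft (\sum_(i | Q i) z i *~ n i) =
    \sum_(i | Q i) twist_and_glue c onleft (z i) *~ n i.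
Proof. by rewrite /twist_and_glue /kink_map lin_sum; apply: glue_sum. Qed.

(** The effect of a twist-and-glue move on polynomials; [a] bears the kink. *)
Definition twist_poly (t : C * bool) (f : sqfree) : sqfree :=
  let a := if t.2 then lft D t.1 else rgt D t.1 in
  let b := if t.2 then rgt D t.1 else lft D t.1 in
  if positive D t.1
  then xmul (seifert_circle D b) f - xmul (seifert_circle D a) f else f.

Lemma twist_and_glue_realize P c onleft (f : sqfree) :
  c \in crossings D -> c \notin P ->
  twist_and_glue c onleft (realize (F P) f) =
    realize (F (c |: P)) (twist_poly (c, onleft) f).
Proof.
move=> cD cP; rewrite twist_and_glue_sum.
have /andP[aD bD] := foot_arcs wf onleft cD.
rewrite /twist_poly /=; case: ifP => cpos; last first.
  apply: eq_bigr => S sS.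
  by rewrite (twist_and_glue_kgen wf) ?cpos //; apply: stable_cover.
rewrite raddfB /= !realize_xmul // -sumrB; apply: eq_bigr => S sS.
rewrite (twist_and_glue_kgen wf) ?cpos //; last exact: stable_cover.
by rewrite mulrzBl.
Qed.

Lemma is_enhanced0 (X : diagram A C) : is_enhanced X (set0, set0).
Proof. by rewrite /is_enhanced !sub0set /=; apply/forall_inP => a; rewrite inE. Qed.

Lemma run_births_kgen Q bs :
  run_births bs (kgen (frame D Q set0) set0 set0) = kgen (F set0) set0 set0.
Proof.
elim: bs Q => [|K bs IH] Q /=; last rewrite [birth_map _ _]lin_kgen ?IH //;
  [rewrite [birth_map _ _]lin_kgen // |]; exact: is_enhanced0.
Qed.

Lemma run_glues_realize P cs (f : sqfree) :
  uniq [seq t.1 | t <- cs] ->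
  {in [seq t.1 | t <- cs], forall c, c \in crossings D /\ c \notin P} ->
  P :|: [set c in [seq t.1 | t <- cs]] = crossings D ->
  run_glues cs (realize (F P) f) =
    realize D (foldl (fun g t => twist_poly t g) f cs).
Proof.
elim: cs P f => [|[c onleft] cs IH] P f /=.
  move=> _ _; rewrite set_nil setU0 => PE; subst P.
  rewrite [birth_map _ _]lin_sum; apply: eq_bigr => S sS; congr (_ *~ _).
  exact/lin_kgen/is_enhanced_frame/stable_cover.
case/andP=> ncs ucs csP PE; have [cD cP] := csP c (mem_head _ _).
rewrite twist_and_glue_realize // IH //.
  move=> c' c'cs; have [|c'D c'P] := csP c'; first by rewrite inE c'cs orbT.
  split=> //; rewrite !inE negb_or c'P andbT.
  by apply: contraNneq ncs => <-.
by rewrite -PE set_cons setUCA setUA.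
Qed.

Lemma CKJ_realize (m : seifert_movie D) :
  CKJ m = realize D (foldl (fun g t => twist_poly t g) (mono set0) (poss m)).
Proof.
rewrite /CKJ run_births_kgen.
have -> : kgen (F set0) set0 set0 = realize (F set0) (mono set0).
  rewrite realize_mono ?sub0set // /cover big_set0; congr (kgen _ _ _).
  by apply/setP => c; rewrite !inE.
case: m => births negs poss pb pn pp /=.
have neg c : (c \in [seq t.1 | t <- negs]) = (c \in crossings D) && ~~ positive D c.
  by rewrite (perm_mem pn) mem_enum inE.
have pos c : (c \in [seq t.1 | t <- poss]) = (c \in crossings D) && positive D c.
  by rewrite (perm_mem pp) mem_enum inE.
rewrite run_glues_realize.
- rewrite foldl_cat; congr (realize _ (foldl _ _ _)).
  have : all (fun t => ~~ positive D t.1) negs.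
    by apply/allP => t tn; have := map_f fst tn; rewrite neg => /andP[].
  by elim: (negs) (mono set0) => //= t s IH g /andP[/negPf tn /IH]; rewrite /twist_poly tn.
- rewrite map_cat cat_uniq (perm_uniq pn) (perm_uniq pp) !enum_uniq andbT /=.
  by apply/hasPn => c; rewrite pos neg => /andP[-> ->].
- by move=> c; rewrite map_cat mem_cat neg pos inE; case: (c \in crossings D).
apply/setP => c; rewrite !inE map_cat mem_cat neg pos.
by case: (c \in crossings D); case: positive.
Qed.

End Realization.

(** * The graph of positive crossings *)

Section GraphOfPositiveCrossings.
Variables (A C : finType) (D : diagram A C).
Hypothesis wf : well_formed D.

Local Notation G := (Gamma0 D).

Lemma Gamma0_edges : edges G = [set c in crossings D | positive D c].
Proof.
by apply/setP => c; rewrite !inE; case: (c \in crossings D); rewrite //= negbK.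
Qed.

Lemma Gamma0_end1 c : end1 G c = seifert_circle D (lft D c).
Proof. by []. Qed.

Lemma Gamma0_end2 c : c \in edges G -> end2 G c = seifert_circle D (rgt D c).
Proof.
rewrite Gamma0_edges => /setIdP[cD _] /=.
by rewrite (negPf (seifert_state_oriented cD)).
Qed.

Lemma Gamma0_ends c : c \in edges G -> (end1 G c \in verts G) && (end2 G c \in verts G).
Proof.
move=> cG; have : c \in crossings D by move: cG; rewrite Gamma0_edges => /setIdP[].
case: wf => _ H _ _ _ /H[lD rD].
apply/andP; split; rewrite inE.
  rewrite [X in X && _]imset_f //; apply/exists_inP; exists c => //.
  by rewrite eqxx.
rewrite {1}(Gamma0_end2 cG) [X in X && _]imset_f //; apply/exists_inP; exists c => //.
by rewrite eqxx orbT.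
Qed.

(** Heights on different components of the diagram need not differ by integers,
    so their parity is that of the floor. *)
Definition even_floor (q : rat) : bool := (2 %| Num.floor q)%Z.

Lemma even_floorD1 q : even_floor (q + 1) = ~~ even_floor q.
Proof.
rewrite /even_floor floorDrz // floor1; move: (Num.floor q) => n; lia.
Qed.

(** The colour of a Seifert circle is the parity of its height, which is the same
    for all its arcs. *)
Lemma Gamma0_bipartite : planar D ->
  exists col : {set A} -> bool,
    forall c, c \in edges G -> col (end1 G c) != col (end2 G c).
Proof.
move=> pl; have [g [gN gC]] := seifert_heights wf pl.
exists (fun K : {set A} => [exists a in K, even_floor (g a)]) => c cG.
rewrite Gamma0_end1 Gamma0_end2 //.
have cD : c \in crossings D by move: cG; rewrite Gamma0_edges => /setIdP[].
have [lD rD] : lft D c \in arcs D /\ rgt D c \in arcs D by case: wf => _ H _ _ _; apply: H.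
have colE a : a \in arcs D ->
    [exists b in seifert_circle D a, even_floor (g b)] = even_floor (g a).
  move=> aD; apply/exists_inP/idP => [[b]|ga]; last first.
    by exists a => //; rewrite seifert_circleE connect0.
  rewrite seifert_circleE => /connectP[p pp ->].
  elim: p a aD pp => //= x p IH a aD /andP[/eqP ax xp].
  by rewrite -(gN a aD) ax; apply: IH; rewrite // -ax next_arcsE.
by rewrite !colE // gC // even_floorD1; case: even_floor.
Qed.

(** Creating the kink on the other side of the crossing exchanges the two ends of
    the edge, which only changes the sign. *)
Lemma twist_poly_edge_prod (ps : seq (C * bool)) f :
  {subset [seq t.1 | t <- ps] <= edges G} ->
  pm_eq (foldl (fun g t => twist_poly D t g) f ps)
        (edge_prod G [seq t.1 | t <- ps] f).
Proof.
elim: ps f => [|[c onleft] ps IH] f psG /=; first exact: pm_eq_refl.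
apply: pm_eq_trans (IH _ _) _ => [t tps|].
  by apply: psG; rewrite inE tps orbT.
apply: pm_edge_prod; have cG := psG c (mem_head _ _).
rewrite /twist_poly /edge_diff (Gamma0_end2 cG) Gamma0_end1 /=.
move: cG; rewrite Gamma0_edges => /setIdP[_ ->].
by case: onleft {psG}; [right; rewrite opprB | left].
Qed.

End GraphOfPositiveCrossings.

Theorem theorem4p6 (A C : finType) (D : diagram A C) (hD : link_diagram D)
    (m : seifert_movie D) (hconn : graph_connected (Gamma0 D)) :
  [/\ betti1 (Gamma0 D) = 0%N ->
        forall v0 : {set A}, v0 \in verts (Gamma0 D) ->
        eq_up_to_sign (CKJ m)
          (\sum_(v in verts (Gamma0 D))
             alpha D v *~ (-1) ^+ distance (Gamma0 D) v v0),
      betti1 (Gamma0 D) = 1%N ->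
        eq_up_to_sign (CKJ m) (seifert_gen D (verts (Gamma0 D)) *+ 2)
    & (2 <= betti1 (Gamma0 D))%N -> CKJ m = 0].
Proof.
case: hD => wf _ pl; set G := Gamma0 D.
have ends := Gamma0_ends wf.
have [col colP] := Gamma0_bipartite wf pl.
have vertsD : verts G \subset circles D (seifert_state D).
  by apply/subsetP => v; rewrite inE => /andP[].
have main v : v \in verts G ->
    pm_eq (CKJ m) (realize D D (level col (verts G) (betti1 G))).
  move=> vG; rewrite CKJ_realize //.
  have possE : perm_eq [seq t.1 | t <- poss m] (enum (edges G)).
    by rewrite Gamma0_edges; case: m.
  have [j [jE jP]] := edge_prod_connected ends colP hconn vG possE.
  have -> : betti1 G = j.
    by apply/eqP; rewrite -(eqn_add2r #|verts G|) (betti1_connected ends hconn vG) jE.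
  apply: pm_eq_additive; apply: pm_eq_trans jP.
  by apply: twist_poly_edge_prod => c; rewrite (perm_mem possE) mem_enum.
have posb : (0 < betti1 G)%N -> exists v, v \in verts G.
  move=> b0; have /card_gt0P[c /ends/andP[cG _]] : (0 < #|edges G|)%N.
    exact: leq_trans b0 (leq_subr _ _).
  by exists (end1 G c).
split=> [b0 v0 v0G | b1 | b2].
- have := main v0 v0G; rewrite b0 /level raddf_sum => /pm_eq_trans; apply.
  (* The colours and the distances to [v0] give the same signs, up to the
     colour of [v0]. *)
  set alternating := (X in pm_eq _ X).
  suffices -> : \sum_(v in verts G) realize D D (mono (verts G :\ v) *~ (-1) ^+ col v)
      = alternating *~ (-1) ^+ col v0 by apply: pm_eq_sign.
  rewrite /alternating mulrz_suml; apply: eq_bigr => v vG.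
  rewrite raddfMz /= realize_mono; last exact: subset_trans (subD1set _ _) vertsD.
  rewrite -mulrzA; congr (_ *~ _).
  by rewrite -[in RHS]signr_odd (distance_parity hconn colP) // signr_addb -mulrA
    -expr2 sqrr_sign mulr1.
- have [|v vG] := posb; first by rewrite b1.
  by have := main v vG; rewrite b1 /level raddfMn /= realize_mono.
have [|v vG] := posb; first exact: leq_trans b2.
have := main v vG; case: (betti1 G) b2 => [|[|k]] // _.
by rewrite /level raddf0 => -[->|->]; rewrite ?oppr0.
Qed.
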